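(* For each $n\ge 5$, $P_n^3\times\overleftrightarrow{K_2}$ and $P_n^4\times\overleftrightarrow{K_2}$ form a pair of noncospectral equienergetic sidigraphs, each of order $2n$ and with energy equal to $2n$.
   Context: A sidigraph (signed digraph) is a pair $S=(D,\sigma)$, where $D=(V,\mathscr{A})$ is a digraph and $\sigma:\mathscr{A}\to\{-1,1\}$. Its adjacency matrix $A(S)=(a_{ij})$ has $a_{ij}=\sigma(v_i,v_j)$ if there is an arc from $v_i$ to $v_j$ and $0$ otherwise. The energy of $S$ is $E(S)=\sum_j|\Re z_j|$, where the $z_j$ are the eigenvalues of $A(S)$ with multiplicity. Two sidigraphs on the same number of vertices are cospectral if they have the same spectrum (with multiplicities); two nonisomorphic sidigraphs of the same order are equienergetic if they have equal energy. $\mathbf{C}_l$ is a negative directed cycle on $l$ vertices (product of arc signs equal to $-1$). The path $P_m$ ($m\ge2$) is the sidigraph on vertices $v_1,\dots,v_m$ with signed arcs $(v_i,v_{i+1})$, $1\le i\le m-1$. For $n\ge l+1$, $P_n^l$ is a sidigraph on $n$ vertices obtained by identifying one pendant vertex (end vertex) of the path $P_{n-l+1}$ with any vertex of $\mathbf{C}_l$; the signs of the non-cyclic arcs are arbitrary. $\overleftrightarrow{K_2}$ is the symmetric digraph on two vertices $u,v$ with arcs $(u,v)$ and $(v,u)$, both positive. The cartesian product $S_1\times S_2$ of $S_1=(V_1,A_1,\sigma_1)$ and $S_2=(V_2,A_2,\sigma_2)$ is the sidigraph on $V_1\times V_2$ with an arc from $(u_i,v_j)$ to $(u_k,v_l)$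 iff either $j=l$ and $(u_i,u_k)\in A_1$ (with sign $\sigma_1(u_i,u_k)$), or $i=k$ and $(v_j,v_l)\in A_2$ (with sign $\sigma_2(v_j,v_l)$). *)

(* Defs.v *)
From HB Require Import structures.
From mathcomp Require Import all_boot all_order all_algebra.
From mathcomp Require Import complex reals.

Set Implicit Arguments.
Unset Strict Implicit.
Unset Printing Implicit Defensive.

Import Order.TTheory GRing.Theory Num.Theory.
Local Open Scope ring_scope.

(* Digraphs have no loops and no parallel arcs.  [sgn] is total for
   convenience; its values at pairs that are not arcs are irrelevant. *)
Record sidigraph (V : finType) := Sidigraph {
  arc : rel V;
  arc_irr : irreflexive arc;
  sgn : V -> V -> int;
  sgnP : forall u v, arc u v -> sgn u v = 1 \/ sgn u v = -1
}.

Definition sdorder (V : finType) (S : sidigraph V) : nat := #|V|.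

Definition adjmx (V : finType) (S : sidigraph V) : 'M[int]_#|V| :=
  \matrix_(i, j) if arc S (enum_val i) (enum_val j)
                 then sgn S (enum_val i) (enum_val j) else 0.

(* The roots of the characteristic polynomial, with multiplicity. *)
Definition spectrum (R : realType) (V : finType) (S : sidigraph V) :
    seq R[i] :=
  sval (closed_field_poly_normal
          (char_poly (map_mx (fun z : int => z%:~R : R[i]) (adjmx S)))).

Definition energy (R : realType) (V : finType) (S : sidigraph V) : R :=
  \sum_(z <- spectrum R S) `|complex.Re z|.

Definition cospectral (R : realType) (V1 V2 : finType)
    (S1 : sidigraph V1) (S2 : sidigraph V2) : Prop :=
  sdorder S1 = sdorder S2 /\ perm_eq (spectrum R S1) (spectrum R S2).

Definition isomorphic (V1 V2 : finType)
    (S1 : sidigraph V1) (S2 : sidigraph V2) : Prop :=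
  exists f : V1 -> V2,
    [/\ bijective f,
        forall u v, arc S2 (f u) (f v) = arc S1 u v
      & forall u v, arc S1 u v -> sgn S2 (f u) (f v) = sgn S1 u v].

Definition equienergetic (R : realType) (V1 V2 : finType)
    (S1 : sidigraph V1) (S2 : sidigraph V2) : Prop :=
  [/\ sdorder S1 = sdorder S2, ~ isomorphic S1 S2
    & energy R S1 = energy R S2].

(* [ordS i] is i + 1 modulo l. *)
Definition is_negative_cycle (l : nat) (S : sidigraph 'I_l) : Prop :=
  (forall i j, arc S i j = (j == ordS i)) /\
  \prod_(i < l) sgn S i (ordS i) = -1.

Definition is_path (m : nat) (S : sidigraph 'I_m) : Prop :=
  forall i j, arc S i j = (j == i.+1 :> nat).

Definition is_path_end (m : nat) (y : 'I_m) : Prop :=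
  y = 0%N :> nat \/ y.+1 = m.

Section Identify.
Variables (V1 V2 : finType) (S1 : sidigraph V1) (S2 : sidigraph V2).
Variables (x : V1) (y : V2).

(* The disjoint union of S1 and S2 with x and y identified: the vertex y of
   S2 is dropped, and [inl x] takes its place. *)
Definition identify_vertex : finType := (V1 + {z : V2 | z != y})%type.

Definition identify_arc (u v : identify_vertex) : bool :=
  match u, v with
  | inl a, inl b => arc S1 a b
  | inl a, inr c => (a == x) && arc S2 y (val c)
  | inr c, inl b => (b == x) && arc S2 (val c) y
  | inr c, inr d => arc S2 (val c) (val d)
  end.

Definition identify_sgn (u v : identify_vertex) : int :=
  match u, v with
  | inl a, inl b => sgn S1 a b
  | inl _, inr c => sgn S2 y (val c)
  | inr c, inl _ => sgn S2 (val c) y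
  | inr c, inr d => sgn S2 (val c) (val d)
  end.

Lemma identify_irr : irreflexive identify_arc.
Proof. by case=> a /=; exact: arc_irr. Qed.

Lemma identify_sgnP u v :
  identify_arc u v -> identify_sgn u v = 1 \/ identify_sgn u v = -1.
Proof. by case: u v => a [] b /= => [|/andP[_]|/andP[_]|]; exact: sgnP. Qed.

Definition identify : sidigraph identify_vertex :=
  Sidigraph identify_irr identify_sgnP.
End Identify.

(* The signs on the path are arbitrary.  The path has n - l + 1 vertices; either of
   its ends may be the identified one, so it may leave or enter the cycle. *)
Definition is_Pnl (n l : nat) (V : finType) (S : sidigraph V) : Prop :=
  (l < n)%N /\
  exists (C : sidigraph 'I_l) (P : sidigraph 'I_(n - l).+1)
         (x : 'I_l) (y : 'I_(n - l).+1),
    [/\ is_negative_cycle C, is_path P, is_path_end y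
      & isomorphic S (identify C P x y)].

Lemma K2_irr : irreflexive (fun u v : bool => u != v).
Proof. by move=> u; rewrite eqxx. Qed.

Lemma K2_sgnP (u v : bool) : u != v -> (1 : int) = 1 \/ (1 : int) = -1.
Proof. by left. Qed.

Definition symK2 : sidigraph bool :=
  @Sidigraph bool (fun u v => u != v) K2_irr (fun _ _ => 1) K2_sgnP.

Section CartesianProduct.
Variables (V1 V2 : finType) (S1 : sidigraph V1) (S2 : sidigraph V2).

Definition cart_arc (p q : V1 * V2) : bool :=
  (p.2 == q.2) && arc S1 p.1 q.1 || (p.1 == q.1) && arc S2 p.2 q.2.

(* The two kinds of arcs are disjoint because there are no loops. *)
Definition cart_sgn (p q : V1 * V2) : int :=
  if p.2 == q.2 then sgn S1 p.1 q.1 else sgn S2 p.2 q.2.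

Lemma cart_irr : irreflexive cart_arc.
Proof. by move=> p; rewrite /cart_arc !arc_irr !andbF. Qed.

Lemma cart_sgnP p q : cart_arc p q -> cart_sgn p q = 1 \/ cart_sgn p q = -1.
Proof.
rewrite /cart_arc /cart_sgn; case: eqP => [->|_] /=.
  by rewrite arc_irr andbF orbF; exact: sgnP.
by case/andP=> _; exact: sgnP.
Qed.

Definition cart : sidigraph (V1 * V2)%type := Sidigraph cart_irr cart_sgnP.
End CartesianProduct.

(* Main.v *)
(** Ordering the cycle vertices before the path vertices makes the adjacency
    matrix of P_n^l block triangular with a nilpotent path block, so its
    characteristic polynomial is (X^l + 1) X^(n-l), and all its eigenvalues
    have modulus at most 1.  The spectrum of S x K_2 consists of the z + 1 and
    z - 1 for z in the spectrum of S, and |a + 1| + |a - 1| = 2 for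
    -1 <= a <= 1: hence the energy 2n.  Finally 0 is an eigenvalue of
    P_n^l x K_2 iff 1 or -1 is a root of X^l + 1, i.e. iff l is odd. *)

Require Import Defs.
From HB Require Import structures.
From mathcomp Require Import all_boot all_order all_algebra.
From mathcomp Require Import fingroup perm complex reals.

Set Implicit Arguments.
Unset Strict Implicit.
Unset Printing Implicit Defensive.

Import Defs Order.TTheory GRing.Theory Num.Theory.
Local Open Scope ring_scope.

(** * Determinants and characteristic polynomials of matrices *)

(** Two enumerations of [V] differ by a permutation, which acts on rows and columns at once, so its
    sign enters squared. *)
Lemma det_reindex (R : comNzRingType) (V : finType) (M : V -> V -> R) m n
    (f : 'I_m -> V) (g : 'I_n -> V) : bijective f -> bijective g ->
  \det (\matrix_(i, j) M (f i) (f j)) = \det (\matrix_(i, j) M (g i) (g j)).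
Proof.
move=> bf bg.
have mn : m = n.
  by rewrite -(card_ord m) -(card_ord n) (bij_eq_card bf) (bij_eq_card bg).
subst n; case: bg => g' gK g'K; have inj_s : injective (g' \o f).
  exact/inj_comp/bij_inj/bf/can_inj/g'K.
set s := perm inj_s.
have -> : (\matrix_(i, j) M (f i) (f j)) =
          row_perm s (col_perm s (\matrix_(i, j) M (g i) (g j))).
  by apply/matrixP=> i j; rewrite !mxE !permE /= !g'K.
rewrite row_permE col_permE !det_mulmx !det_perm odd_permV.
by rewrite mulrCA -signr_addb addbb mulr1.
Qed.

Lemma char_poly_mxE (R : comNzRingType) n (A : 'M[R]_n) :
  char_poly_mx A = \matrix_(i, j) ('X *+ (i == j) - (A i j)%:P).
Proof. by apply/matrixP=> i j; rewrite !mxE. Qed.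

Lemma char_poly_reindex (R : comNzRingType) (V : finType) (M : V -> V -> R) m n
    (f : 'I_m -> V) (g : 'I_n -> V) : bijective f -> bijective g ->
  char_poly (\matrix_(i, j) M (f i) (f j)) =
  char_poly (\matrix_(i, j) M (g i) (g j)).
Proof.
move=> bf bg; rewrite /char_poly !char_poly_mxE.
(* As [h] is injective, the diagonal can be tested in [V]; the whole characteristic matrix is then
   indexed by [V]. *)
have charE k (h : 'I_k -> V) : bijective h ->
    (\matrix_(i, j) ('X *+ (i == j) -
       ((\matrix_(i, j) M (h i) (h j)) i j)%:P) : 'M[{poly R}]_k) =
    \matrix_(i, j) ('X *+ (h i == h j) - (M (h i) (h j))%:P).
  by move=> bh; apply/matrixP=> i j; rewrite !mxE (inj_eq (bij_inj bh)).
rewrite !charE //.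
exact: (@det_reindex _ V (fun u v => 'X *+ (u == v) - (M u v)%:P)).
Qed.

Lemma char_poly_ublock (R : comNzRingType) m n
    (A : 'M[R]_m) (B : 'M_(m, n)) (D : 'M_n) :
  char_poly (block_mx A B 0 D) = char_poly A * char_poly D.
Proof.
rewrite /char_poly -(det_ublock _ (- map_mx polyC B)); congr (\det _).
by rewrite /char_poly_mx map_block_mx scalar_mx_block opp_block_mx add_block_mx
  map_mx0 subr0 add0r.
Qed.

Lemma char_poly_lblock (R : comNzRingType) m n
    (A : 'M[R]_m) (C : 'M_(n, m)) (D : 'M_n) :
  char_poly (block_mx A 0 C D) = char_poly A * char_poly D.
Proof.
rewrite /char_poly -(det_lblock _ (- map_mx polyC C)); congr (\det _).
by rewrite /char_poly_mx map_block_mx scalar_mx_block opp_block_mx add_block_mx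
  map_mx0 subr0 add0r.
Qed.

(** Adding the second block row to the first, then subtracting the first block column from the
    second, leaves a block triangular matrix; no commutation of [A] and [B] is involved. *)
Lemma det_block_sym (R : comNzRingType) n (A B : 'M[R]_n) :
  \det (block_mx A B B A) = \det (A + B) * \det (A - B).
Proof.
have E : block_mx 1%:M 1%:M 0 1%:M *m block_mx A B B A
         *m block_mx 1%:M (- 1%:M) 0 1%:M = block_mx (A + B) 0 B (A - B).
  rewrite !mulmx_block !mul1mx !mul0mx !mulmx0 !mulmx1 !add0r !addr0 !mulmxN.
  by rewrite !mulmx1 [B + A]addrC addNr [- B + A]addrC.
by rewrite -(det_lblock _ B) -E !det_mulmx !det_ublock !det1 !mul1r mulr1.
Qed.

(** Substituting ['X - c] for ['X] is a ring morphism, hence commutes with the determinant. *)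
Lemma char_poly_shift (R : comNzRingType) n (A : 'M[R]_n) c :
  \det (char_poly_mx A - (c%:P)%:M) = char_poly A \Po ('X - c%:P).
Proof.
rewrite /char_poly -[RHS]det_map_mx; congr (\det _).
apply/matrixP=> i j; rewrite !mxE rmorphB rmorphMn /= comp_polyX comp_polyC.
by rewrite mulrnBl addrAC.
Qed.

(** Laplace expansion along the first column, whose nonzero entries lie in the first and last rows;
    these rows are distinct because the size is at least 2. *)
Lemma char_poly_weighted_cycle (R : comNzRingType) n (w : 'I_n.+2 -> R) :
  char_poly (\matrix_(i, j) if j == ordS i then w i else 0) =
  'X^(n.+2) - (\prod_i w i)%:P.
Proof.
rewrite /char_poly char_poly_mxE; set M := (X in \det X).
have ME (i j : 'I_n.+2) : M i j = 'X *+ (i == j :> nat) -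
    (if j == (if i == n.+1 :> nat then 0 else i.+1) :> nat
     then (w i)%:P else 0).
  rewrite !mxE -!val_eqE fun_if polyC0 /=.
  case: (eqVneq (i : nat) n.+1) => [->|neq].
    by rewrite modnn.
  by rewrite modn_small // ltn_neqAle eqSS neq ltn_ord.
move: (M) ME => {}M ME.
(* The two surviving minors of the first column are triangular. *)
rewrite (expand_det_col _ ord0) big_ord_recl big_ord_recr /=.
rewrite big1 ?add0r; last first.
  move=> i _; rewrite ME /=.
  by rewrite /bump /= add1n eqSS (ltn_eqF (ltn_ord i)) /= mulr0n subr0 mul0r.
have -> : cofactor M ord0 ord0 = 'X^(n.+1).
  (* This minor is upper triangular, hence the transposition. *)
  rewrite /cofactor /= expr0 mul1r -det_tr det_trig.
    rewrite (eq_bigr (fun=> 'X)) ?prodr_const ?card_ord // => i _.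
    rewrite !mxE ME eqxx /= /bump /= !add1n eqSS.
    by case: (eqVneq (i : nat) n) => _; rewrite ?subr0 // ltn_eqF ?subr0.
  apply/is_trig_mxP => i j ij.
  rewrite !mxE ME /= /bump /= !add1n eqSS gtn_eqF //.
  rewrite [X in if X then _ else _](_ : _ = false) ?subr0 //.
  by case: ifP => _ //; rewrite eqSS ltn_eqF // ltnW.
have -> : cofactor M (lift ord0 ord_max) ord0 =
          \prod_(i < n.+1) (w (widen_ord (leqnSn _) i))%:P.
  have liftE i : lift (lift ord0 ord_max) i = widen_ord (leqnSn _) i.
    by apply: val_inj; rewrite /= /bump /= add1n leqNgt ltn_ord.
  rewrite /cofactor det_trig /=.
    rewrite (eq_bigr (fun i => - (w (widen_ord (leqnSn _) i))%:P)) => [|i _].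
      (* The [n.+1] minus signs on the diagonal cancel the cofactor sign [(-1)^(n.+1)]. *)
      rewrite prodrN card_ord mulrA -exprD.
      by rewrite /bump /= add1n addn0 addnn -mul2n exprM sqrrN !expr1n mul1r.
    rewrite !mxE liftE ME /= /bump /= add1n (ltn_eqF (ltnSn i)) mulr0n sub0r.
    by rewrite (ltn_eqF (ltn_ord i)) eqxx.
  apply/is_trig_mxP => i j ij; rewrite !mxE liftE ME /= /bump /= add1n.
  rewrite (ltn_eqF (ltn_ord i)) eqSS (gtn_eqF ij) subr0.
  by rewrite (ltn_eqF (leqW ij)).
rewrite !ME /= /bump /= eqxx mulr1n mulr0n subr0 sub0r -exprS mulNr.
rewrite [in RHS]big_ord_recr /= rmorphM rmorph_prod mulrC.
by rewrite (_ : lift ord0 ord_max = ord_max) //; exact: val_inj.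
Qed.

(** * Characteristic polynomials of sidigraphs *)

(** Indexing by vertices instead of ordinals lets each sidigraph be enumerated in whichever order
    gives a convenient block form. *)
Definition adjf (V : finType) (S : sidigraph V) (u v : V) : int :=
  if arc S u v then sgn S u v else 0.

Definition sdchar (V : finType) (S : sidigraph V) : {poly int} :=
  char_poly (adjmx S).

Lemma adjf_loop (V : finType) (S : sidigraph V) u : adjf S u u = 0.
Proof. by rewrite /adjf arc_irr. Qed.

Lemma sdchar_enum (V : finType) (S : sidigraph V) n (f : 'I_n -> V) :
  bijective f -> sdchar S = char_poly (\matrix_(i, j) adjf S (f i) (f j)).
Proof. exact/char_poly_reindex/enum_val_bij. Qed.

Lemma sdchar_isomorphic (V1 V2 : finType)
    (S1 : sidigraph V1) (S2 : sidigraph V2) :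
  isomorphic S1 S2 -> sdchar S1 = sdchar S2.
Proof.
case=> f [bf arcE sgnE].
rewrite (sdchar_enum S2 (bij_comp bf (enum_val_bij V1))).
congr char_poly; apply/matrixP=> i j; rewrite !mxE /adjf /= arcE.
by case: ifP => // /sgnE.
Qed.

Lemma order_isomorphic (V1 V2 : finType)
    (S1 : sidigraph V1) (S2 : sidigraph V2) :
  isomorphic S1 S2 -> sdorder S1 = sdorder S2.
Proof. by case=> f [bf _ _]; exact: bij_eq_card bf. Qed.

Section OrdSum.
Variables (U V : finType) (m n : nat) (f : 'I_m -> U) (g : 'I_n -> V).

Definition ord_sum (i : 'I_(m + n)) : U + V :=
  match split i with inl a => inl (f a) | inr b => inr (g b) end.

Lemma ord_sum_bij : bijective f -> bijective g -> bijective ord_sum.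
Proof.
case=> f' fK f'K [g' gK g'K].
exists (fun s => unsplit match s with
                         | inl a => inl (f' a)
                         | inr b => inr (g' b)
                         end).
  move=> i; rewrite /ord_sum -[RHS]splitK.
  by case: split => a; rewrite (fK, gK).
by case=> a; rewrite /ord_sum unsplitK (f'K, g'K).
Qed.

Lemma matrix_ord_sum (T : Type) (M : U + V -> U + V -> T) :
  \matrix_(i, j) M (ord_sum i) (ord_sum j) =
  block_mx (\matrix_(i, j) M (inl (f i)) (inl (f j)))
           (\matrix_(i, j) M (inl (f i)) (inr (g j)))
           (\matrix_(i, j) M (inr (g i)) (inl (f j)))
           (\matrix_(i, j) M (inr (g i)) (inr (g j))).
Proof.
apply/matrixP=> i j; rewrite !mxE /ord_sum.
by case: (split i) => a; rewrite mxE; case: (split j) => b; rewrite mxE.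
Qed.
End OrdSum.

(** Listing one copy of [V] after the other gives the adjacency matrix with diagonal blocks [A] and
    off-diagonal blocks the identity, so [det_block_sym] applies. *)
Lemma sdchar_cart_K2 (V : finType) (S : sidigraph V) :
  sdchar (cart S symK2) =
  (sdchar S \Po ('X - 1%:P)) * (sdchar S \Po ('X - (-1)%:P)).
Proof.
pose h (s : V + V) : V * bool :=
  match s with inl u => (u, false) | inr u => (u, true) end.
have bh : bijective h.
  exists (fun p => if p.2 then inr p.1 else inl p.1); first by case.
  by case=> u [].
have be := enum_val_bij V.
rewrite (sdchar_enum _ (bij_comp bh (ord_sum_bij be be))).
rewrite (matrix_ord_sum _ _ (fun s t => adjf (cart S symK2) (h s) (h t))).
set A := adjmx S.
rewrite [X in char_poly X](_ : _ = block_mx A 1%:M 1%:M A); last first.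
  congr block_mx; apply/matrixP=> i j;
    rewrite !mxE /adjf /= /cart_arc /cart_sgn /= ?andbF ?orbF //;
    by rewrite andbT (inj_eq (bij_inj be)); case: eqP.
rewrite /sdchar -!char_poly_shift -/A.
rewrite /char_poly /char_poly_mx map_block_mx scalar_mx_block.
rewrite opp_block_mx add_block_mx !map_mx1 !add0r det_block_sym.
by rewrite rmorphN /= rmorphN /= opprK.
Qed.

Lemma sdchar_negative_cycle l (C : sidigraph 'I_l) :
  (1 < l)%N -> is_negative_cycle C -> sdchar C = 'X^l + 1.
Proof.
case: l C => [|[|l]] // C _ [arcE prodE].
have bid : bijective (@id 'I_l.+2) by exists id.
(* The constant 1 is rewritten as minus the product of the arc signs, to match the weighted
   cycle. *)
rewrite (sdchar_enum _ bid) -[1]opprK -[- 1](rmorphN1 polyC) -prodE.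
rewrite -char_poly_weighted_cycle; congr char_poly.
apply/matrixP=> i j; rewrite !mxE /adjf arcE.
by case: eqP => // ->.
Qed.

(** The arcs between the cycle and the rest of the path all go in one direction, so one off-diagonal
    block is zero; which one depends on the end identified. *)
Lemma sdchar_identify_path l (C : sidigraph 'I_l) m (P : sidigraph 'I_m.+1)
    (x : 'I_l) (y : 'I_m.+1) :
  is_path P -> is_path_end y ->
  sdchar (identify C P x y) = sdchar C * 'X^m.
Proof.
move=> arcE endy.
have liftP (i : 'I_m) : lift y (rev_ord i) != y by rewrite eq_sym neq_lift.
(* Reversal, because [is_trig_mx] means lower triangular. *)
pose g (i : 'I_m) : {z | z != y} := exist (fun z => z != y) _ (liftP i).
have bg : bijective g.
  apply: inj_card_bij => [i j /(congr1 val)/lift_inj/rev_ord_inj //|].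
  by rewrite card_sig (cardC1 y) !card_ord.
have bid : bijective (@id 'I_l) by exists id.
rewrite (sdchar_enum _ (ord_sum_bij bid bg)) (sdchar_enum C bid).
rewrite (matrix_ord_sum _ _ (adjf (identify C P x y))).
set D := (X in block_mx _ _ _ X).
have -> : 'X^m = char_poly D.
  rewrite char_poly_trig => [|/=].
    rewrite (eq_bigr (fun=> 'X)) ?prodr_const ?card_ord // => i _.
    by rewrite mxE adjf_loop subr0.
  apply/is_trig_mxP => i j ij; rewrite mxE /adjf /= arcE /= ltn_eqF //.
  by rewrite ltnS leq_bump2; apply: leq_sub2l; rewrite ltnW.
case: endy => yE.
  (* No path arc enters the initial vertex. *)
  rewrite [X in block_mx _ _ X _](_ : _ = 0) ?char_poly_ublock //.
  by apply/matrixP=> i j; rewrite !mxE /adjf /= arcE yE andbF.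
(* No path arc leaves the final vertex. *)
rewrite [X in block_mx _ X _ _](_ : _ = 0) ?char_poly_lblock //.
by apply/matrixP=> i j; rewrite !mxE /adjf /= arcE yE ltn_eqF ?andbF.
Qed.

Lemma sdchar_Pnl n l (V : finType) (S : sidigraph V) :
  (1 < l)%N -> is_Pnl n l S -> sdchar S = ('X^l + 1) * 'X^(n - l).
Proof.
move=> l_gt1 [_ [C [P [x [y [negC pathP endy isoS]]]]]].
by rewrite (sdchar_isomorphic isoS) sdchar_identify_path //
  sdchar_negative_cycle.
Qed.

Lemma order_Pnl n l (V : finType) (S : sidigraph V) :
  is_Pnl n l S -> sdorder S = n.
Proof.
case=> ln [C [P [x [y [_ _ _ isoS]]]]]; rewrite (order_isomorphic isoS).
by rewrite /sdorder card_sum card_sig (cardC1 y) !card_ord /= subnKC // ltnW.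
Qed.

Lemma order_cart_K2 (V : finType) (S : sidigraph V) :
  sdorder (cart S symK2) = (2 * sdorder S)%N.
Proof. by rewrite /sdorder card_prod card_bool mulnC. Qed.

(** * Eigenvalues and energy *)

Section Spectrum.
Variable R : realType.

Lemma prod_spectrum (V : finType) (S : sidigraph V) :
  \prod_(z <- spectrum R S) ('X - z%:P) = map_poly intr (sdchar S).
Proof.
rewrite /spectrum; case: closed_field_poly_normal => s /= sE.
by rewrite /sdchar map_char_poly sE (monicP (char_poly_monic _)) scale1r.
Qed.

Lemma mem_spectrum (V : finType) (S : sidigraph V) (z : R[i]) :
  (z \in spectrum R S) = root (map_poly intr (sdchar S)) z.
Proof. by rewrite -prod_spectrum root_prod_XsubC. Qed.

Lemma size_spectrum (V : finType) (S : sidigraph V) :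
  size (spectrum R S) = sdorder S.
Proof.
have /eqP := congr1 (fun p : {poly R[i]} => size p) (prod_spectrum S).
by rewrite size_prod_XsubC /sdchar map_char_poly size_char_poly => /eqP[].
Qed.

(** Used in contrapositive form, to obtain nonisomorphism from noncospectrality. *)
Lemma isomorphic_cospectral (V1 V2 : finType)
    (S1 : sidigraph V1) (S2 : sidigraph V2) :
  isomorphic S1 S2 -> cospectral R S1 S2.
Proof.
move=> iso12; split; first exact: order_isomorphic iso12.
by apply: prod_XsubC_eq; rewrite !prod_spectrum (sdchar_isomorphic iso12).
Qed.

Lemma spectrum_cart_K2 (V : finType) (S : sidigraph V) :
  perm_eq (spectrum R (cart S symK2))
    ([seq z + 1 | z <- spectrum R S] ++ [seq z - 1 | z <- spectrum R S]).
Proof.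
apply: prod_XsubC_eq.
rewrite prod_spectrum sdchar_cart_K2 rmorphM big_cat !big_map /=.
(* Composing with ['X - c] translates every root by [c]. *)
have shift c : map_poly intr (sdchar S \Po ('X - c%:P)) =
    \prod_(z <- spectrum R S) ('X - (z + c%:~R)%:P).
  rewrite map_comp_poly rmorphB /= map_polyX map_polyC -prod_spectrum.
  rewrite rmorph_prod; apply: eq_bigr => z _ /=.
  by rewrite comp_polyB comp_polyX comp_polyC polyCD opprD addrAC addrA.
by rewrite !shift.
Qed.

Lemma energy_cart_K2 (V : finType) (S : sidigraph V) :
  {in spectrum R S, forall z, `|complex.Re z| <= 1} ->
  energy R (cart S symK2) = (2 * sdorder S)%:R.
Proof.
move=> le1; rewrite /energy (perm_big _ (spectrum_cart_K2 S)).
(* Merging the two sums pairs [z + 1] with [z - 1], so each [z] contributes exactly 2. *)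
rewrite big_cat !big_map /= -big_split /= -size_spectrum.
rewrite (eq_big_seq (fun=> 2)) => [|z /le1].
  by rewrite big_const_seq count_predT iter_addr_0 natrM mulr_natr.
case: z => a b /=; rewrite ler_norml => /andP[a_ge a_le].
rewrite ger0_norm -?lerBlDr ?sub0r // ler0_norm ?subr_le0 //.
by rewrite opprB [a + 1]addrC addrACA subrr addr0.
Qed.

Lemma Re_root_XnD1 l m (z : R[i]) : (0 < l)%N ->
  root (map_poly intr (('X^l + 1) * 'X^m)) z -> `|complex.Re z| <= 1.
Proof.
move=> l_gt0; rewrite rmorphM rmorphD rmorph1 /= !map_polyXn rootM.
suff le1 : `|z| <= 1 -> `|complex.Re z| <= 1.
  (* Either [z^l = -1], so that [|z|^l = 1], or [z^m = 0], which forces [z = 0]. *)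
  case/orP; rewrite /root !hornerE => /eqP zE; apply: le1.
    have := congr1 Num.norm (addr0_eq zE); rewrite normrN normrX normr1 => zl1.
    by rewrite -(ler_pXn2r l_gt0) ?nnegrE // zl1 expr1n.
  case: m zE => [|m] /eqP; rewrite ?oner_eq0 // expf_eq0 /= => /eqP->.
  by rewrite normr0.
(* The norm of [z] has values in [R[i]], that of its real part in [R]; the bound is carried over by
   the embedding [real_complex]. *)
by move/(le_trans (normc_ge_Re z)); rewrite -[1](rmorph1 (real_complex R)) lecR.
Qed.

Lemma energy_Pnl_cart_K2 n l (V : finType) (S : sidigraph V) :
  (1 < l)%N -> is_Pnl n l S -> energy R (cart S symK2) = (2 * n)%:R.
Proof.
move=> l_gt1 hS; rewrite energy_cart_K2 ?(order_Pnl hS) // => z.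
rewrite mem_spectrum (sdchar_Pnl l_gt1 hS); exact/Re_root_XnD1/ltnW.
Qed.

(** The invariant that tells the cases [l = 3] and [l = 4] apart. *)
Lemma mem0_spectrum_Pnl_cart_K2 n l (V : finType) (S : sidigraph V) :
  (1 < l)%N -> is_Pnl n l S -> (0 \in spectrum R (cart S symK2)) = odd l.
Proof.
move=> l_gt1 hS; rewrite (perm_mem (spectrum_cart_K2 S)) mem_cat.
have zE c : (0 \in [seq z + c | z <- spectrum R S]) = (- c \in spectrum R S).
  apply/mapP/idP => [[z zS /eqP]|cS]; last by exists (- c); rewrite ?addNr.
  by rewrite eq_sym addr_eq0 => /eqP <-.
rewrite !zE opprK !mem_spectrum (sdchar_Pnl l_gt1 hS).
rewrite rmorphM rmorphD rmorph1 /= !map_polyXn !rootM /root !hornerE.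
(* The power of ['X] does not vanish at 1 or -1, and [1^l + 1 = 2] is nonzero; only the vanishing of
   [(-1)^l + 1] remains. *)
rewrite !expr1n oner_eq0 signr_eq0 /= !orbF -[1 + 1]/(2%:R) pnatr_eq0 orbF.
rewrite -signr_odd; case: (odd l); rewrite ?addNr ?eqxx //.
by rewrite -[_ + 1]/(2%:R) pnatr_eq0.
Qed.
End Spectrum.

Theorem corollary6p4 (R : realType) (n : nat) (hn : (5 <= n)%N)
    (V3 V4 : finType) (S3 : sidigraph V3) (S4 : sidigraph V4)
    (hS3 : is_Pnl n 3 S3) (hS4 : is_Pnl n 4 S4) :
  [/\ ~ cospectral R (cart S3 symK2) (cart S4 symK2),
      equienergetic R (cart S3 symK2) (cart S4 symK2),
      sdorder (cart S3 symK2) = (2 * n)%N /\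
      sdorder (cart S4 symK2) = (2 * n)%N
    & energy R (cart S3 symK2) = (2 * n)%:R /\
      energy R (cart S4 symK2) = (2 * n)%:R].
Proof.
have ncosp : ~ cospectral R (cart S3 symK2) (cart S4 symK2).
  (* The eigenvalue 0 occurs for [l = 3] and not for [l = 4]. *)
  case=> _ /perm_mem/(_ 0).
  by rewrite (mem0_spectrum_Pnl_cart_K2 _ _ hS3) //
    (mem0_spectrum_Pnl_cart_K2 _ _ hS4).
have e3 := energy_Pnl_cart_K2 R (isT : 1 < 3)%N hS3.
have e4 := energy_Pnl_cart_K2 R (isT : 1 < 4)%N hS4.
have [o3 o4] := (order_Pnl hS3, order_Pnl hS4).
split=> //; last by rewrite !order_cart_K2 o3 o4.
split; [by rewrite !order_cart_K2 o3 o4| |by rewrite e3 e4].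
by move/(isomorphic_cospectral R).
Qed.
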